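(* Let $N$ be a natural number. Every finite base phi expansion of $N$ with digits $0$ and $1$ can be obtained from the Bergman expansion $\beta(N)$ of $N$ by a finite number of applications of the golden mean flip.
   Context: Let $\varphi=(1+\sqrt5)/2$. A finite base phi expansion of $N$ with digits $0$ and $1$ is a bi-infinite sequence $(a_i)_{i\in\mathbb Z}$ with $a_i\in\{0,1\}$, only finitely many $a_i$ nonzero, and $N=\sum_{i\in\mathbb Z} a_i\varphi^i$; it is written $a_La_{L-1}\dots a_0\cdot a_{-1}\dots a_{R+1}a_R$, all digits outside the positions $R,\dots,L$ being $0$. The Bergman expansion $\beta(N)$ is the unique finite base phi expansion $(d_i)$ of $N$ with digits in $\{0,1\}$ in which $d_{i+1}d_i=11$ never occurs. The golden mean flip at position $i$ may be applied to an expansion $(a_j)$ when $a_{i+1}a_ia_{i-1}=100$; it replaces these three digits by $011$ and leaves all other digits unchanged. (The positions $i$ and $i-1$ may lie to the right of the last nonzero digit, where the digits are $0$.) Since $\varphi^{i+1}=\varphi^i+\varphi^{i-1}$, the result is again an expansion of $N$. *)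

(* Defs.v *)
From mathcomp Require Import all_boot all_order all_algebra.
From mathcomp Require Import boolp classical_sets functions cardinality fsbigop reals.
From Stdlib Require Import Relation_Operators.

Set Implicit Arguments.
Unset Strict Implicit.
Unset Printing Implicit Defensive.

Import Order.TTheory GRing.Theory Num.Theory.
Local Open Scope classical_set_scope.
Local Open Scope ring_scope.

(* The digit [a i] is the coefficient of [phi ^ i]; [true] stands for 1. *)
Definition digits := int -> bool.

Definition phi (R : realType) : R := (1 + Num.sqrt 5) / 2.

(* The sum over [setT] is a sum over the support of its terms, with value 0 if
   that support is infinite; hence the separate finiteness condition. *)
Definition is_expansion (R : realType) (N : nat) (a : digits) : Prop :=
  finite_set [set i | a i] /\
  N%:R = \sum_(i \in [set: int]) (a i)%:R * phi R ^ i.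

Definition is_bergman (R : realType) (N : nat) (d : digits) : Prop :=
  is_expansion R N d /\ forall i : int, ~~ (d (i + 1) && d i).

(* Bergman's theorem: exactly one sequence satisfies [is_bergman R N], so the
   default [fun=> false] of [xget] is never used. *)
Definition bergman (R : realType) (N : nat) : digits :=
  xget (fun=> false) [set d : digits | is_bergman R N d].

Definition flippable (i : int) (a : digits) : bool :=
  [&& a (i + 1), ~~ a i & ~~ a (i - 1)].

Definition flip_at (i : int) (a : digits) : digits := fun j =>
  if j == i + 1 then false
  else if (j == i) || (j == i - 1) then true
  else a j.

Definition golden_mean_flip (a b : digits) : Prop :=
  exists2 i : int, flippable i a & b = flip_at i a.

Definition obtained_by_flips : digits -> digits -> Prop :=
  clos_refl_trans digits golden_mean_flip.

(* Main.v *)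
Require Import Defs.
From mathcomp Require Import all_boot all_order all_algebra.
From mathcomp Require Import boolp classical_sets functions cardinality fsbigop reals.
From mathcomp Require Import zify ring lra.
From Stdlib Require Import Relation_Operators.

(** Read backwards, a golden mean flip replaces [011] by [100]; it preserves the
    value and lowers the number of digits 1 by one ([digit_sum_flip], applied
    with two different weights).  If an expansion contains [11], the block of 1s
    through this place has a 0 on its left, as there are finitely many 1s, so a
    backward flip is possible ([exists_011]).  Backward flips thus lead
    from any expansion, in finitely many steps, to an expansion of the same
    number without [11] ([flips_from_no11]).

    There is only one such expansion ([is_bergman_unique]), so this endpoint is
    the Bergman expansion, and the same flips read forwards lead from it to the
    given expansion.  Uniqueness is the greedy argument: without [11], the digits
    below position [k] contribute strictly less than [phi ^ k]
    ([no11_window_lt]), so at the highest position where two expansions differ,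
    the one with digit 1 has the larger value.  *)

Set Implicit Arguments.
Unset Strict Implicit.
Unset Printing Implicit Defensive.

Import Order.TTheory GRing.Theory Num.Theory.
Local Open Scope classical_set_scope.
Local Open Scope ring_scope.

(** The weight [w] is arbitrary so that one flip identity serves both for the
    value ([w i = phi ^ i]) and for the number of digits 1 ([w i = 1] in [nat]). *)
Definition digit_sum (V : pzSemiRingType) (w : int -> V) (a : digits) : V :=
  \sum_(i \in [set: int]) (a i)%:R * w i.

Definition no11 (a : digits) : Prop := forall i : int, ~~ (a (i + 1) && a i).

Lemma digit_sumE (V : pzSemiRingType) (w : int -> V) (a : digits) (r : seq int) :
  uniq r -> (forall i, a i -> i \in r) ->
  digit_sum w a = \sum_(i <- r) (a i)%:R * w i.
Proof.
move=> ur ar; rewrite /digit_sum (fsbigE r) //.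
  by apply: eq_bigl => i; rewrite in_setT.
by move=> i _ ir; case E: (a i); [rewrite ar in ir|rewrite mul0r].
Qed.

Lemma finite_digitsP (a : digits) :
  finite_set [set i | a i] -> exists s : seq int, forall i, a i -> i \in s.
Proof.
move=> /finite_seqP[s As]; exists s => i ai.
by have : [set i | a i] i by []; rewrite As.
Qed.

Lemma sum_indicator (V : pzSemiRingType) (w : int -> V) (r : seq int) (k : int) :
  uniq r -> k \in r -> \sum_(i <- r) (i == k)%:R * w i = w k.
Proof.
move=> ur kr; rewrite (bigD1_seq k) //= eqxx mul1r big1 ?addr0 // => i /negbTE->.
by rewrite mul0r.
Qed.

Lemma finite_flip_at (i : int) (b : digits) :
  finite_set [set j | flip_at i b j] -> finite_set [set j | b j].
Proof.
move=> fa; apply: (@sub_finite_set _ _ ([set j | flip_at i b j] `|` [set i + 1])).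
  move=> j /= bj; rewrite /flip_at; case: eqP => [->|_]; first by right.
  by left; case: ifP.
by rewrite finite_setU; split.
Qed.

Lemma digit_sum_flip (V : pzSemiRingType) (w : int -> V) (i : int) (b : digits) :
  finite_set [set j | b j] -> flippable i b ->
  digit_sum w (flip_at i b) + w (i + 1) = digit_sum w b + w i + w (i - 1).
Proof.
move=> /finite_digitsP[s bs] /and3P[b1 b0 bN].
pose r := undup [:: i + 1, i, i - 1 & s].
have ur : uniq r by exact: undup_uniq.
have rE j : (j \in r) = [|| j == i + 1, j == i, j == i - 1 | j \in s].
  by rewrite mem_undup !inE.
rewrite (digit_sumE w ur) => [|j]; last first.
  by rewrite /flip_at rE; do ![case: eqP => //= _]; exact: bs.
rewrite (digit_sumE (a := b) w ur) => [|j /bs js]; last by rewrite rE js !orbT.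
rewrite -(sum_indicator w ur (k := i + 1)) ?rE ?eqxx //.
rewrite -(sum_indicator w ur (k := i)) ?rE ?eqxx ?orbT //.
rewrite -(sum_indicator w ur (k := i - 1)) ?rE ?eqxx ?orbT //.
rewrite -!big_split /=; apply: eq_bigr => j _; rewrite -!mulrDl; congr (_ * _).
rewrite /flip_at; have [->|] := eqVneq j (i + 1).
  have -> : (i + 1 == i) = false by lia.
  have -> : (i + 1 == i - 1) = false by lia.
  by rewrite b1 !addr0 add0r.
have [->|] := eqVneq j i.
  have -> : (i == i - 1) = false by lia.
  by rewrite (negbTE b0) !addr0 add0r.
by have [->|] := eqVneq j (i - 1); rewrite ?(negbTE bN) ?addr0 ?add0r.
Qed.

Lemma exists_011 (a : digits) (i : int) :
  finite_set [set j | a j] -> a (i + 1) && a i ->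
  exists j : int, [&& ~~ a (j + 1), a j & a (j - 1)].
Proof.
move=> /finite_digitsP[s as_] /andP[a1 a0].
have ex : exists n : nat, ~~ a (i + 1 + n%:Z).
  (* This far above [i], the position exceeds every element of [s]. *)
  exists (\max_(j <- s) `|j - i|)%N; apply/negP => /as_ js.
  have := @leq_bigmax_seq _ s xpredT (fun j => `|j - i|%N) _ js isT.
  by set m := bigop.body _ _ _; lia.
case: (ex_minnP ex) => -[|[|n]] an min; first by rewrite addr0 a1 in an.
  by exists (i + 1); rewrite an a1 addrK a0.
have am m : (m < n.+2)%N -> a (i + 1 + m%:Z).
  by move=> mn; apply: contraLR mn => /min; rewrite -leqNgt.
exists (i + 1 + n.+1%:Z); apply/and3P; split; last 1 first.
- by rewrite (_ : _ - 1 = i + 1 + n%:Z); [apply: am | lia].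
- by rewrite (_ : _ + 1 = i + 1 + n.+2%:Z) //; lia.
- exact: am.
Qed.

Definition unflip_at (i : int) (a : digits) : digits := fun j =>
  if j == i + 1 then true
  else if (j == i) || (j == i - 1) then false
  else a j.

Lemma unflip_atK (i : int) (a : digits) :
  [&& ~~ a (i + 1), a i & a (i - 1)] -> flip_at i (unflip_at i a) = a.
Proof.
move=> /and3P[/negbTE a1 a0 aN]; apply/funext => j; rewrite /flip_at /unflip_at.
by case: eqVneq => [->//|_]; do 2!case: eqVneq => [->//|_].
Qed.

Lemma flippable_unflip_at (i : int) (a : digits) : flippable i (unflip_at i a).
Proof.
rewrite /flippable /unflip_at !eqxx !orbT /=.
have -> : (i == i + 1) = false by lia.
by have -> : (i - 1 == i + 1) = false by lia.
Qed.

(** Stated for any weight with the Fibonacci recurrence, the only property of the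
    powers of [phi] that keeps the value unchanged under flips. *)
Lemma flips_from_no11 (V : pzRingType) (w : int -> V) (a : digits) :
  (forall i, w (i + 1) = w i + w (i - 1)) -> finite_set [set i | a i] ->
  exists b : digits, [/\ finite_set [set i | b i], digit_sum w b = digit_sum w a,
                no11 b & obtained_by_flips b a].
Proof.
(* Induction on the number of digits 1 of [a]. *)
move=> wE; have [n] := ubnP (digit_sum (fun=> 1%N) a).
elim: n a => // n IHn a; rewrite ltnS => an fa.
have [a11|/existsNP[i /negP/negPn/(exists_011 fa)[j ja]]] := pselect (no11 a).
  by exists a; split => //; exact: rt_refl.
have aE := unflip_atK ja; have fl := flippable_unflip_at j a.
move: aE fl; set c := unflip_at j a => aE fl.
have fc : finite_set [set i | c i] by apply: (@finite_flip_at j); rewrite aE.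
have cn : (digit_sum (fun=> 1%N) c < n)%N.
  have := digit_sum_flip (fun=> 1%N) fc fl; rewrite aE => eqn.
  suff aS : digit_sum (fun=> 1%N) a = (digit_sum (fun=> 1%N) c).+1 by rewrite -aS.
  by apply: (@addIn 1); rewrite -(addn1 (digit_sum _ c)); exact: eqn.
have [b [fb bc b11 flb]] := IHn c cn fc; exists b; split => //.
  rewrite bc; have := digit_sum_flip w fc fl.
  by rewrite aE wE -addrA => /addIr.
by apply: rt_trans flb _; apply: rt_step; exists j.
Qed.

Section Phi.
Variable R : realType.
Local Notation phi := (phi R).

Lemma phi_gt1 : 1 < phi.
Proof.
have : 1 < Num.sqrt 5 :> R by rewrite -{1}sqrtr1 ltr_sqrt //; lra.
by rewrite /Defs.phi; lra.
Qed.

Lemma phi_sqr : phi ^+ 2 = phi + 1.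
Proof.
have : Num.sqrt 5 ^+ 2 = 5 :> R by rewrite sqr_sqrtr.
by rewrite /Defs.phi => H; field : H.
Qed.

Lemma phi_exp_rec (i : int) : phi ^ (i + 1) = phi ^ i + phi ^ (i - 1).
Proof.
have phi0 : phi != 0 by have := phi_gt1; lra.
have -> : i + 1 = (i - 1) + 2 by lia.
have -> : phi ^ i = phi ^ (i - 1) * phi by rewrite -{3}[phi]expr1z -expfzDr // subrK.
rewrite expfzDr // (_ : phi ^ 2%Z = phi + 1) ?mulrDr ?mulr1 //.
exact: phi_sqr.
Qed.

Lemma phi_exp_gt0 (i : int) : 0 < phi ^ i.
Proof. by apply: exprz_gt0; have := phi_gt1; lra. Qed.

Definition window_sum (a : digits) (l : int) (n : nat) : R :=
  \sum_(k < n) (a (l + k%:Z))%:R * phi ^ (l + k%:Z).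

Lemma window_sumS (a : digits) (l : int) (n : nat) :
  window_sum a l n.+1 = window_sum a l n + (a (l + n%:Z))%:R * phi ^ (l + n%:Z).
Proof. exact: big_ord_recr. Qed.

(** A digit 1 at the top leaves a 0 below it, and [phi ^ n + phi ^ n.+1 =
    phi ^ n.+2]: hence an induction with step two. *)
Lemma no11_window_lt (a : digits) (l : int) (n : nat) :
  no11 a -> window_sum a l n < phi ^ (l + n%:Z).
Proof.
move=> a11.
have step m : phi ^ (l + m.+2%:Z) = phi ^ (l + m.+1%:Z) + phi ^ (l + m%:Z).
  rewrite (_ : l + m.+2%:Z = l + m.+1%:Z + 1); last lia.
  by rewrite phi_exp_rec; congr (_ + phi ^ _); lia.
have phi_lt m : phi ^ (l + m%:Z) < phi ^ (l + m.+1%:Z).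
  by rewrite ltr_eXz2l ?phi_gt1 //; lia.
suff [] : window_sum a l n < phi ^ (l + n%:Z) /\
          window_sum a l n.+1 < phi ^ (l + n.+1%:Z) by [].
elim: n => [|n [IH0 IH1]].
  rewrite window_sumS /window_sum big_ord0 add0r; split; first exact: phi_exp_gt0.
  have := phi_lt 0%N; have := phi_exp_gt0 (l + 1).
  by case: (a _); rewrite ?mul1r ?mul0r.
split=> //; rewrite window_sumS.
have [atop|atop] := boolP (a (l + n.+1%:Z)); last first.
  by rewrite mul0r addr0; exact: lt_trans IH1 (phi_lt _).
have anext : a (l + n%:Z) = false.
  apply: contraNF (a11 (l + n%:Z)) => ->; rewrite andbT.
  by rewrite (_ : _ + 1 = l + n.+1%:Z) //; lia.
by rewrite mul1r window_sumS anext mul0r addr0 step addrC ltrD2l.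
Qed.

Lemma no11_window_inj (a b : digits) (l : int) (n : nat) :
  no11 a -> no11 b -> window_sum a l n = window_sum b l n ->
  forall k, (k < n)%N -> a (l + k%:Z) = b (l + k%:Z).
Proof.
have sum_ge0 c m : 0 <= window_sum c l m.
  by apply: sumr_ge0 => k _; rewrite mulr_ge0 ?ler0n // ltW ?phi_exp_gt0.
move=> a11 b11; elim: n => // n IHn; rewrite !window_sumS => eqS.
have eq_top : a (l + n%:Z) = b (l + n%:Z).
  have := no11_window_lt l n a11; have := no11_window_lt l n b11.
  (* If the top digits differed, [phi ^ (l + n)] plus a nonnegative sum would
     equal a sum below [phi ^ (l + n)]. *)
  have := sum_ge0 a n; have := sum_ge0 b n; move: eqS.
  by case: (a _); case: (b _) => //; rewrite ?mul1r ?mul0r; lra.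
move: eqS; rewrite eq_top => /addIr/IHn{}IHn k.
by rewrite ltnS leq_eqVlt => /predU1P[->//|/IHn].
Qed.

(** The uniqueness argument goes down from a highest position; a window gives the
    sum over all positions an end from which to start. *)
Lemma digit_sum_window (a : digits) (l : int) (n : nat) :
  (forall i, a i -> l <= i < l + n%:Z) ->
  digit_sum (fun i => phi ^ i) a = window_sum a l n.
Proof.
move=> al; rewrite (@digit_sumE _ _ _ [seq l + k%:Z | k <- iota 0 n]).
- by rewrite big_map -{1}[n]subn0 -/(index_iota 0 n) big_mkord.
- by rewrite map_inj_uniq ?iota_uniq // => x y; lia.
- move=> i /al /andP[li ln]; apply/mapP; exists `|i - l|%N; last lia.
  by rewrite mem_iota; lia.
Qed.

Lemma is_bergman_unique (N : nat) (a b : digits) :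
  is_bergman R N a -> is_bergman R N b -> a = b.
Proof.
move=> [[/finite_digitsP[s sa] Na] a11] [[/finite_digitsP[t tb] Nb] b11].
pose m : nat := (\max_(j <- s ++ t) `|j|)%N.
have bnd i : a i || b i -> - m%:Z <= i < - m%:Z + (m + m).+1%:Z.
  move=> abi; have /(@leq_bigmax_seq _ (s ++ t) xpredT (fun j => `|j|%N))/(_ isT) : i \in s ++ t.
    by rewrite mem_cat; case/orP: abi => [/sa->//|/tb->]; rewrite orbT.
  by rewrite -/m; lia.
have eqab : window_sum a (- m%:Z) (m + m).+1 = window_sum b (- m%:Z) (m + m).+1.
  rewrite -!digit_sum_window ?/digit_sum -?Na -?Nb // => i hi; apply: bnd.
    by rewrite hi orbT.
  by rewrite hi.
apply/funext => i; have [/bnd ib|] := boolP (a i || b i); last first.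
  by rewrite negb_or => /andP[/negbTE-> /negbTE->].
have -> : i = - m%:Z + `|(i + m%:Z)%R|%N%:Z by lia.
by apply: (no11_window_inj a11 b11 eqab); lia.
Qed.

End Phi.

Theorem theorem2p1 (R : realType) (N : nat) (a : digits)
  (ha : is_expansion R N a) :
  obtained_by_flips (bergman R N) a.
Proof.
case: ha => fa Na.
have [b [fb ba b11 flips]] := flips_from_no11 (@phi_exp_rec R) fa.
have bB : is_bergman R N b by split=> //; split; rewrite // Na -[LHS]ba.
rewrite /bergman (xget_unique _ bB) // => c cB.
exact: is_bergman_unique cB bB.
Qed.
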